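(* Let $\mathscr{A}$ be a unital Kreĭn C*-algebra with a given fundamental symmetry $\alpha:\mathscr{A}\to\mathscr{A}$, and put $\mathscr{A}_+:=\{x\in\mathscr{A}\mid\alpha(x)=x\}$ and $\mathscr{A}_-:=\{x\in\mathscr{A}\mid\alpha(x)=-x\}$. Let $\mathscr{C}_{(\mathscr{A},\alpha)}:=[\mathscr{A}_+,\mathscr{A}_-]$ have the two objects $+$ and $-$, morphism spaces $\mathrm{Hom}(+,+)=\mathrm{Hom}(-,-)=\mathscr{A}_+$ and $\mathrm{Hom}(+,-)=\mathrm{Hom}(-,+)=\mathscr{A}_-$, composition given by the multiplication of $\mathscr{A}$, and involution given by the involution $*$ of $\mathscr{A}$ (sending $\mathrm{Hom}(A,B)$ to $\mathrm{Hom}(B,A)$). Then $\mathscr{C}_{(\mathscr{A},\alpha)}$ is a Kreĭn C*-category.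
   Context: A (complex) Kreĭn C*-algebra is a complex associative algebra $\mathscr{A}$ with a conjugate-linear involution $*$ satisfying $(x^* )^*=x$ and $(xy)^*=y^*x^*$, that admits at least one Banach (complete algebra) norm $\|\cdot\|$ and at least one $*$-automorphism $\alpha:\mathscr{A}\to\mathscr{A}$ such that $\alpha\circ\alpha=\mathrm{Id}_{\mathscr{A}}$ and $\|\alpha(x^* )x\|=\|x\|^2$ for all $x\in\mathscr{A}$. Such an $\alpha$ is called a fundamental symmetry of $\mathscr{A}$. A $*$-category is a category whose Hom sets are complex vector spaces, with bilinear composition, equipped with a contravariant, involutive, conjugate-linear functor $*$ acting identically on objects. A covariant $*$-functor is a functor that is linear on each Hom space and satisfies $\phi(x^* )=\phi(x)^*$. A Kreĭn C*-category is a $*$-category $\mathscr{C}$ that admits at least one norm making all the spaces $\mathrm{Hom}_{\mathscr{C}}(A,B)$ Banach spaces and at least one covariant $*$-functor $\alpha:\mathscr{C}\to\mathscr{C}$ such that: $\alpha\circ\alpha=\mathrm{Id}_{\mathscr{C}}$; $\alpha(A)=A$ for all objects $A$; $\|\alpha(x^* )x\|=\|x\|^2$ for all morphisms $x$; and, for every morphism $x$ for which $x^*x$ is an endomorphism of the object $A$, the element $\alpha(x^* )x$ is positive in the C*-algebra $\mathrm{Hom}_{\mathscr{C}}(A,A)$ with involution $y\mapsto\alpha(y^* )$. *)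

(* Defs.v *)
From HB Require Import structures.
From mathcomp Require Import all_boot all_order all_algebra.
From mathcomp Require Import complex reals.
Set Implicit Arguments.
Unset Strict Implicit.
Unset Printing Implicit Defensive.
Import Order.TTheory GRing.Theory Num.Theory.
Local Open Scope ring_scope.
Local Open Scope complex_scope.

Section Algebras.
Variables (R : realType) (V : lmodType R[i]).

Definition complete_norm (nrm : V -> R) : Prop :=
  forall u : nat -> V,
    (forall e : R, 0 < e ->
       exists N, forall m n, (N <= m)%N -> (N <= n)%N -> nrm (u m - u n) < e) ->
    exists l : V, forall e : R, 0 < e ->
       exists N, forall n, (N <= n)%N -> nrm (u n - l) < e.

(* Nonnegativity of nrm follows from the first three fields. *)
Record banach_norm (nrm : V -> R) : Prop := BanachNorm {
  norm_triangle : forall x y, nrm (x + y) <= nrm x + nrm y;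
  norm_homog : forall (k : R[i]) x, (nrm (k *: x))%:C = `|k| * (nrm x)%:C;
  norm_definite : forall x, nrm x = 0 -> x = 0;
  norm_complete : complete_norm nrm
}.

Record banach_algebra_norm (mul : V -> V -> V) (nrm : V -> R) : Prop :=
  BanachAlgebraNorm {
  banach_algebra_banach : banach_norm nrm;
  banach_algebra_normM : forall x y, nrm (mul x y) <= nrm x * nrm y
}.

(* Algebras are given by plain operations on an lmodType rather than by an
   algType: this does not exclude the zero algebra, and it applies as is to the
   endomorphism spaces of a category. *)
Record unital_algebra (mul : V -> V -> V) (one : V) : Prop := UnitalAlgebra {
  alg_mulA : associative mul;
  alg_mul1l : left_id one mul;
  alg_mul1r : right_id one mul;
  alg_linearl : forall y, linear (mul^~ y);
  alg_linearr : forall x, linear (mul x)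
}.

Record star_involution (mul : V -> V -> V) (star : V -> V) : Prop :=
  StarInvolution {
  star_conjlinear : forall (k : R[i]) x y,
    star (k *: x + y) = k^* *: star x + star y;
  starK : forall x, star (star x) = x;
  starM : forall x y, star (mul x y) = mul (star y) (star x)
}.

Record unital_cstar_algebra (mul : V -> V -> V) (one : V) (star : V -> V)
    (nrm : V -> R) : Prop := UnitalCstarAlgebra {
  cstar_algebra : unital_algebra mul one;
  cstar_involution : star_involution mul star;
  cstar_banach : banach_algebra_norm mul nrm;
  cstar_identity : forall x, nrm (mul (star x) x) = nrm x ^+ 2
}.

Definition in_spectrum (mul : V -> V -> V) (one : V) (x : V) (l : R[i]) : Prop :=
  ~ exists y, mul y (x - l *: one) = one /\ mul (x - l *: one) y = one.

(* The order of R[i] satisfies 0 <= l iff l is real and nonnegative. *)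
Definition cstar_positive (mul : V -> V -> V) (one : V) (star : V -> V) (x : V)
    : Prop :=
  star x = x /\ forall l : R[i], in_spectrum mul one x l -> 0 <= l.

(* Bijectivity of alpha follows from fsymK, preservation of units from fsymK
   and fsymM. *)
Record fundamental_symmetry (mul : V -> V -> V) (star alpha : V -> V) : Prop :=
  FundamentalSymmetry {
  fsym_linear : linear alpha;
  fsymM : forall x y, alpha (mul x y) = mul (alpha x) (alpha y);
  fsym_star : forall x, alpha (star x) = star (alpha x);
  fsymK : forall x, alpha (alpha x) = x;
  fsym_norm : exists nrm : V -> R, banach_algebra_norm mul nrm /\
    forall x, nrm (mul (alpha (star x)) x) = nrm x ^+ 2
}.

Record unital_krein_cstar_algebra (mul : V -> V -> V) (one : V) (star : V -> V)
    : Prop := UnitalKreinCstarAlgebra {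
  krein_algebra : unital_algebra mul one;
  krein_involution : star_involution mul star;
  krein_fsym : exists alpha : V -> V, fundamental_symmetry mul star alpha
}.

End Algebras.

(* Operations of a *-category; comp x y is x o y. *)
Record starCatData (R : realType) := StarCatData {
  obj : Type;
  hom : obj -> obj -> lmodType R[i];
  idm : forall a, hom a a;
  comp : forall a b c, hom b c -> hom a b -> hom a c;
  cstar : forall a b, hom a b -> hom b a
}.
Arguments idm {R} C a : rename.
Arguments comp {R C a b c} x y : rename.
Arguments cstar {R C a b} x : rename.

Section KreinCategory.
Variables (R : realType) (C : starCatData R).
Implicit Types a b c d : obj C.

Record star_category : Prop := StarCategory {
  compA : forall a b c d (x : hom c d) (y : hom b c) (z : hom a b),
    comp x (comp y z) = comp (comp x y) z;
  comp1l : forall a b (x : hom a b), comp (idm C b) x = x;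
  comp1r : forall a b (x : hom a b), comp x (idm C a) = x;
  comp_linearl : forall a b c (y : hom a b),
    linear (fun x : hom b c => comp x y);
  comp_linearr : forall a b c (x : hom b c),
    linear (fun y : hom a b => comp x y);
  cstar_conjlinear : forall a b (k : R[i]) (x y : hom a b),
    cstar (k *: x + y) = k^* *: cstar x + cstar y;
  cstarK : forall a b (x : hom a b), cstar (cstar x) = x;
  cstar1 : forall a, cstar (idm C a) = idm C a;
  cstar_comp : forall a b c (x : hom b c) (y : hom a b),
    cstar (comp x y) = comp (cstar y) (cstar x)
}.

(* Covariant *-functors from C to C acting identically on objects. *)
Record star_functor (alpha : forall a b, hom a b -> hom a b) : Prop :=
  StarFunctor {
  functor1 : forall a, alpha a a (idm C a) = idm C a;
  functor_comp : forall a b c (x : hom b c) (y : hom a b),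
    alpha a c (comp x y) = comp (alpha b c x) (alpha a b y);
  functor_linear : forall a b, linear (alpha a b);
  functor_star : forall a b (x : hom a b),
    alpha b a (cstar x) = cstar (alpha a b x)
}.

Record category_fundamental_symmetry (nrm : forall a b, hom a b -> R)
    (alpha : forall a b, hom a b -> hom a b) : Prop :=
  CategoryFundamentalSymmetry {
  cfsym_functor : star_functor alpha;
  cfsymK : forall a b (x : hom a b), alpha a b (alpha a b x) = x;
  cfsym_norm : forall a b (x : hom a b),
    nrm a a (comp (alpha b a (cstar x)) x) = nrm a b x ^+ 2;
  cfsym_cstar : forall a,
    unital_cstar_algebra (@comp R C a a a) (idm C a)
      (fun y => alpha a a (cstar y)) (nrm a a);
  cfsym_positive : forall a b (x : hom a b),
    cstar_positive (@comp R C a a a) (idm C a)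
      (fun y => alpha a a (cstar y)) (comp (alpha b a (cstar x)) x)
}.

Definition krein_cstar_category : Prop :=
  star_category /\
  exists (nrm : forall a b, hom a b -> R)
         (alpha : forall a b, hom a b -> hom a b),
    (forall a b, banach_norm (nrm a b)) /\
    category_fundamental_symmetry nrm alpha.

End KreinCategory.

Inductive pm := Plus | Minus.

Section GradedParts.
Variables (R : realType) (A : lmodType R[i]).
Variables (mul : A -> A -> A) (one : A) (star alpha : A -> A).

Definition even_part (x : A) : bool := alpha x == x.
Definition odd_part (x : A) : bool := alpha x == - x.

Definition pm_part (a b : pm) : A -> bool :=
  match a, b with
  | Plus, Plus | Minus, Minus => even_part
  | Plus, Minus | Minus, Plus => odd_part
  end.

Hypothesis algP : unital_krein_cstar_algebra mul one star.
Hypothesis alphaP : fundamental_symmetry mul star alpha.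

(* The dependence on alphaP lets the linear structure be inferred. *)
Definition pm_pred of fundamental_symmetry mul star alpha :=
  fun a b : pm => (pm_part a b : {pred A}).

Lemma linear_opp (f : A -> A) : linear f -> forall x, f (- x) = - f x.
Proof.
move=> fL x; have f0 : f 0 = 0.
  by have := fL (-1) 0 0; rewrite scaler0 addr0 scaleN1r addNr.
by have := fL (-1) x 0; rewrite f0 !addr0 !scaleN1r.
Qed.

Lemma pm_part_submod a b : submod_closed (pm_pred alphaP a b).
Proof.
have alpha0 : alpha 0 = 0.
  by have := fsym_linear alphaP (-1) 0 0; rewrite scaler0 addr0 scaleN1r addNr.
rewrite /pm_pred; split=> [|k x y]; rewrite !unfold_in;
  case: a; case: b; rewrite /pm_part /even_part /odd_part ?alpha0 ?oppr0 //;
  by move=> /eqP ex /eqP ey; rewrite (fsym_linear alphaP) ex ey ?scalerN ?opprD.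
Qed.

Lemma pm_part1 a : one \in pm_pred alphaP a a.
Proof.
have [_ mul1l mul1r _ _] := krein_algebra algP.
have alpha1 : alpha one = one.
  have := fsymM alphaP (alpha one) one.
  by rewrite mul1r (fsymK alphaP) mul1l => <-.
by rewrite unfold_in; case: a; rewrite /= /even_part alpha1.
Qed.

Lemma pm_partM a b c x y :
  x \in pm_pred alphaP b c -> y \in pm_pred alphaP a b ->
  mul x y \in pm_pred alphaP a c.
Proof.
have [_ _ _ mull mulr] := krein_algebra algP.
have mulNx u v : mul (- u) v = - mul u v by exact: linear_opp (mull v) u.
have mulxN u v : mul u (- v) = - mul u v by exact: linear_opp (mulr u) v.
by rewrite !unfold_in; case: a; case: b; case: c;
  rewrite /= /even_part /odd_part => /eqP ex /eqP ey;
  rewrite (fsymM alphaP) ex ey ?mulNx ?mulxN ?opprK.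
Qed.

Lemma pm_part_star a b x :
  x \in pm_pred alphaP a b -> star x \in pm_pred alphaP b a.
Proof.
have starL := star_conjlinear (krein_involution algP).
have star0 : star 0 = 0.
  by have := starL (-1) 0 0; rewrite scaler0 addr0 rmorphN rmorph1 scaleN1r addNr.
have starN u : star (- u) = - star u.
  by have := starL (-1) u 0; rewrite star0 !addr0 rmorphN rmorph1 !scaleN1r.
by rewrite !unfold_in; case: a; case: b; rewrite /= /even_part /odd_part => /eqP ex;
  rewrite (fsym_star alphaP) ex ?starN.
Qed.

HB.instance Definition _ a b :=
  GRing.isSubmodClosed.Build _ _ (pm_pred alphaP a b) (@pm_part_submod a b).

Record pm_hom (a b : pm) := PmHom {
  pm_val : A;
  pm_valP : pm_val \in pm_pred alphaP a b
}.

HB.instance Definition _ a b := [isSub for @pm_val a b].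
HB.instance Definition _ a b := [Choice of pm_hom a b by <:].
HB.instance Definition _ a b := [SubChoice_isSubLmodule of pm_hom a b by <:].

Definition krein_algebra_category : starCatData R :=
  @StarCatData R pm (fun a b => pm_hom a b)
    (fun a => PmHom (pm_part1 a))
    (fun a b c x y => PmHom (pm_partM (pm_valP x) (pm_valP y)))
    (fun a b x => PmHom (pm_part_star (pm_valP x))).

End GradedParts.

(* Main.v *)
From HB Require Import structures.
Require Import Defs.
From mathcomp Require Import all_boot all_order all_algebra.
From mathcomp Require Import complex reals.
From mathcomp Require Import ring lra.

Set Implicit Arguments.
Unset Strict Implicit.
Unset Printing Implicit Defensive.
Import Order.TTheory GRing.Theory Num.Theory.
Local Open Scope ring_scope.
Local Open Scope complex_scope.

(* With x^dag := alpha (x^star), A is a C*-algebra, and an element of A_+ that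
   is invertible in A is invertible in A_+, since its inverse is fixed by alpha.
   Two classical facts are needed: alpha is continuous, so that A_+ and A_- are
   closed, and x^dag x is positive.

   If w is self-adjoint with |w| < 1, there is a self-adjoint c commuting with w
   such that w^2 + c^2 = 1, and w + ic is unitary. Since alpha preserves
   unitaries, this gives |alpha w| <= 1; it also gives |1 - w^2| <= 1 and
   |w^2 (1 - w^2)| <= 1/4.

   For positivity put b := x^dag x. If 1 + b is invertible with inverse y, then
   the Cayley transform w := 1 - 2y has norm at most 4, a bound which does not
   depend on x. Hence 1 + (9/8)^2 b is again invertible, and starting from small
   multiples of x one gets the invertibility of 1 + b for all x. The bound comes
   from z := 2xy: z^dag z = 1 - w^2, so 1 + z z^dag is a sum of squares, which
   bounds the inverse of n - w^2 for n > 2; together with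
   |w^2 (n - w^2)| <= n^2 / 4 for n > |w|^2, this bounds w^2. *)

(** * Geometric decay of real sequences *)

Lemma geometric_small (R : realType) (rho c e : R) :
  0 <= rho < 1 -> 0 < e -> 0 <= c ->
  exists N, forall n, (N <= n)%N -> c * rho ^+ n < e.
Proof.
move=> /andP[rho0 rho1] e0 c0.
(* Bernoulli's inequality in inverted form: [rho ^+ n] is at most 1 / (1 + n (1 - rho)), so an
   Archimedean choice of [N] suffices. *)
have bern n : rho ^+ n * (n%:R * (1 - rho) + 1) <= 1.
  elim: n => [|n IH]; first by rewrite expr0; lra.
  have pw : 0 <= rho ^+ n <= 1 by rewrite exprn_ge0 // exprn_ile1 // ltW.
  have [p0 p1] := andP pw.
  rewrite exprS -natr1; set p := rho ^+ n in IH p0 p1 *.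
  have a1 := ler_wpM2l rho0 IH.
  have a2 : rho * p * (1 - rho) <= 1 - rho.
    by apply: ler_piMl; [lra | apply: mulr_ile1 => //; exact: ltW].
  nra.
pose N := Num.bound (c / (e * (1 - rho))); exists N => n leNn.
have nlt : c / (e * (1 - rho)) < n%:R.
  apply: lt_le_trans (archi_boundP _) _; last by rewrite ler_nat.
  by apply: divr_ge0 => //; apply: mulr_ge0; lra.
rewrite ltr_pdivrMr in nlt; last by apply: mulr_gt0; lra.
have := bern n; have := exprn_ge0 n rho0; set p := rho ^+ n => p0 bp.
have p1 : p * (n%:R * (1 - rho)) <= 1 by rewrite mulrDr in bp; lra.
have [p00|pneq] := eqVneq p 0; first by rewrite p00 mulr0.
have pgt : 0 < p by rewrite lt_def pneq.
have s1 : c * p < n%:R * (e * (1 - rho)) * p by rewrite ltr_pM2r.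
have s2 : e * (p * (n%:R * (1 - rho))) <= e * 1 by rewrite ler_pM2l.
by lra.
Qed.

(** * Banach spaces: convergence and contractions *)

Section BanachSpace.
Variables (R : realType) (V : lmodType R[i]) (nrm : V -> R).
Hypothesis nrmP : banach_norm nrm.
Implicit Types (x y : V) (u : nat -> V).

Lemma nrmD x y : nrm (x + y) <= nrm x + nrm y.
Proof. exact: norm_triangle nrmP x y. Qed.

Lemma nrmZ (r : R) x : nrm (r%:C *: x) = `|r| * nrm x.
Proof.
apply: complexI; rewrite (norm_homog nrmP) rmorphM; congr (_ * _).
by rewrite normc_def /= expr0n addr0 sqrtr_sqr.
Qed.

Lemma nrmi x : nrm ('i *: x) = nrm x.
Proof.
apply: complexI; rewrite (norm_homog nrmP).
by rewrite normc_def /= expr0n expr1n add0r sqrtr1 mul1r.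
Qed.

Lemma nrm0 : nrm 0 = 0.
Proof. by have := nrmZ 0 0; rewrite scaler0 normr0 mul0r. Qed.

Lemma nrmN x : nrm (- x) = nrm x.
Proof.
have := nrmZ (-1) x.
by rewrite normrN normr1 mul1r rmorphN rmorph1 scaleN1r.
Qed.

Lemma nrm_ge0 x : 0 <= nrm x.
Proof. by have := nrmD x (- x); rewrite subrr nrm0 nrmN; lra. Qed.

Lemma nrmB x y : nrm (x - y) <= nrm x + nrm y.
Proof. by rewrite -(nrmN y); exact: nrmD. Qed.

Lemma nrm_distC x y : nrm (x - y) = nrm (y - x).
Proof. by rewrite -nrmN opprB. Qed.

Lemma nrm_dist_triangle z x y : nrm (x - y) <= nrm (x - z) + nrm (z - y).
Proof. by have := nrmD (x - z) (z - y); rewrite addrA subrK. Qed.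

Definition converges u l :=
  forall e : R, 0 < e -> exists N, forall n, (N <= n)%N -> nrm (u n - l) < e.

Lemma converges_unique u l l' : converges u l -> converges u l' -> l = l'.
Proof.
move=> ul ul'; apply/eqP; rewrite -subr_eq0; apply/eqP/(norm_definite nrmP).
apply/eqP; rewrite eq_le nrm_ge0 andbT leNgt; apply/negP => d0.
have d20 : 0 < nrm (l - l') / 2 by lra.
have [N NP] := ul _ d20; have [M MP] := ul' _ d20.
have a := NP _ (leq_maxl N M); have b := MP _ (leq_maxr N M).
have := nrm_dist_triangle (u (maxn N M)) l l'; rewrite (nrm_distC l (u _)); lra.
Qed.

Lemma converges_lipschitz (f : V -> V) (K : R) u l :
  (forall x y, nrm (f x - f y) <= K * nrm (x - y)) ->
  converges u l -> converges (f \o u) (f l).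
Proof.
move=> fK ul e e0.
(* [|K| + 1] is a positive divisor even when [K] is zero or negative. *)
have K0 : 0 < `|K| + 1 by have := normr_ge0 K; lra.
have [N NP] := ul (e / (`|K| + 1)) (divr_gt0 e0 K0).
exists N => n /NP; rewrite ltr_pdivlMr // => lt_e.
apply: le_lt_trans (fK _ _) _; apply: le_lt_trans lt_e.
rewrite mulrC; apply: ler_wpM2l; first exact: nrm_ge0.
by have := ler_norm K; lra.
Qed.

Lemma converges_le u l r : (forall n, nrm (u n) <= r) -> converges u l ->
  nrm l <= r.
Proof.
move=> ur ul; rewrite leNgt; apply/negP => rl.
have /ul[N /(_ N (leqnn N)) uN] : 0 < nrm l - r by lra.
have := nrmD (u N) (l - u N); rewrite subrKC (nrm_distC l).
by have := ur N; lra.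
Qed.

(** Banach's iteration is run inside a closed invariant set [D], so that side conditions such as
    self-adjointness or commutation pass to the fixed point. *)
Lemma contraction_fixpoint (D : V -> Prop) (F : V -> V) (rho : R) (x0 : V) :
  0 <= rho < 1 -> D x0 -> (forall x, D x -> D (F x)) ->
  (forall u l, (forall n, D (u n)) -> converges u l -> D l) ->
  (forall x y, D x -> D y -> nrm (F x - F y) <= rho * nrm (x - y)) ->
  exists2 x, D x & F x = x.
Proof.
move=> rho01 Dx0 DF Dcl FP; have [rho0 rho1] := andP rho01.
pose u n := iter n F x0.
have Du n : D (u n) by elim: n => //= n; exact: DF.
set d := nrm (F x0 - x0); have d0 : 0 <= d := nrm_ge0 _.
have step n : nrm (u n.+1 - u n) <= rho ^+ n * d.
  elim: n => [|n IH]; first by rewrite expr0 mul1r.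
  apply: le_trans (FP _ _ (Du n.+1) (Du n)) _.
  by rewrite exprS -mulrA; exact: ler_wpM2l.
(* Telescoped geometric sum, multiplied by 1 - rho to avoid division. *)
have tele n k : nrm (u (n + k)%N - u n) * (1 - rho) <= d * rho ^+ n.
  suff: nrm (u (n + k)%N - u n) * (1 - rho) <=
        d * rho ^+ n * (1 - rho ^+ k).
    move/le_trans; apply; apply: ler_piMr; first by rewrite mulr_ge0 ?exprn_ge0.
    by rewrite gerBl exprn_ge0.
  elim: k => [|k IH]; first by rewrite addn0 subrr nrm0 expr0 subrr mulr0 mul0r.
  have tri := nrm_dist_triangle (u (n + k)%N) (u (n + k).+1) (u n).
  have st : nrm (u (n + k).+1 - u (n + k)%N) * (1 - rho) <=
            rho ^+ (n + k) * d * (1 - rho).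
    by apply: ler_wpM2r; [lra | exact: step].
  have tri' : nrm (u (n + k).+1 - u n) * (1 - rho) <=
     (nrm (u (n + k).+1 - u (n + k)%N) + nrm (u (n + k)%N - u n)) * (1 - rho).
    by apply: ler_wpM2r; [lra | exact: tri].
  rewrite addnS; apply: le_trans tri' _; rewrite mulrDl.
  apply: le_trans (lerD st IH) _; rewrite exprD exprS le_eqVlt; apply/orP; left.
  by apply/eqP; ring.
have [l ul] : exists l, converges u l.
  apply: (norm_complete nrmP) => e e0.
  have e1 : 0 < e / 2 * (1 - rho) by apply: mulr_gt0; lra.
  have [N NP] := geometric_small rho01 e1 d0.
  exists N => m n Nm Nn.
  have half j : (N <= j)%N -> nrm (u j - u N) < e / 2.
    move=> /subnKC <-; rewrite -(ltr_pM2r (x := 1 - rho)); last by lra.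
    exact: le_lt_trans (tele _ _) (NP _ (leqnn N)).
  have := nrm_dist_triangle (u N) (u m) (u n); rewrite (nrm_distC (u N) (u n)).
  by have := half _ Nm; have := half _ Nn; lra.
have Dl : D l by exact: Dcl ul.
exists l => //.
(* The shifted sequence tends both to [F l] and to [l]. *)
apply: (@converges_unique (fun n => u n.+1)) => e e0; last first.
  by have [N NP] := ul _ e0; exists N => n Nn; apply: NP; exact: leqW.
have [N NP] := ul _ e0; exists N => n Nn.
apply: le_lt_trans (FP _ _ (Du n) Dl) (le_lt_trans _ (NP _ Nn)).
by apply: ler_piMl (nrm_ge0 _) _; exact: ltW.
Qed.

End BanachSpace.

Definition invertible (B : pzRingType) (x : B) :=
  exists y, y * x = 1 /\ x * y = 1.

(** * C*-algebras: adjoints, norms and Neumann inverses *)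

Section CstarAlgebra.
Variables (R : realType) (B : algType R[i]) (st : B -> B) (nrm : B -> R).
Hypothesis BP : unital_cstar_algebra ( *%R : B -> B -> B) 1 st nrm.
Implicit Types (x y z w h : B) (r t : R).

Let rcD r t : (r + t)%:C = r%:C + t%:C. Proof. exact: rmorphD. Qed.
Let rcM r t : (r * t)%:C = r%:C * t%:C. Proof. exact: rmorphM. Qed.

Let nrmP : banach_norm nrm := banach_algebra_banach (cstar_banach BP).
Let nrmD := nrmD nrmP.
Let nrmB := nrmB nrmP.
Let nrmN := nrmN nrmP.
Let nrmZ := nrmZ nrmP.
Let nrmi := nrmi nrmP.
Let nrm_ge0 := nrm_ge0 nrmP.
Let nrmM x y : nrm (x * y) <= nrm x * nrm y.
Proof. exact: banach_algebra_normM (cstar_banach BP) x y. Qed.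
Let stK x : st (st x) = x.
Proof. exact: starK (cstar_involution BP) x. Qed.
Let stM x y : st (x * y) = st y * st x.
Proof. exact: starM (cstar_involution BP) x y. Qed.
Let stL (k : R[i]) x y : st (k *: x + y) = conjc k *: st x + st y.
Proof. exact: star_conjlinear (cstar_involution BP) k x y. Qed.

Let st0 : st 0 = 0.
Proof.
have := stL (-1) 0 0.
by rewrite scaler0 addr0 rmorphN rmorph1 scaleN1r addNr.
Qed.
Let stD x y : st (x + y) = st x + st y.
Proof. by have := stL 1 x y; rewrite rmorph1 !scale1r. Qed.
Let stZ (k : R[i]) x : st (k *: x) = conjc k *: st x.
Proof. by have := stL k x 0; rewrite st0 !addr0. Qed.
Let stZr r x : st (r%:C *: x) = r%:C *: st x.
Proof. by rewrite stZ conjc_real. Qed.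
Let stN x : st (- x) = - st x.
Proof. by rewrite -scaleN1r stZ rmorphN rmorph1 scaleN1r. Qed.
Let stB x y : st (x - y) = st x - st y.
Proof. by rewrite stD stN. Qed.
Let sti x : st ('i *: x) = - ('i *: st x).
Proof.
rewrite stZ -scaleNr; congr (_ *: _).
by apply/eqP; rewrite eq_complex /= oppr0 !eqxx.
Qed.
Let st1 : st 1 = 1.
Proof. by rewrite -[LHS]mulr1 -{2}(stK 1) -stM mulr1 stK. Qed.

Let nrm_sq x : nrm (st x * x) = nrm x ^+ 2.
Proof. exact: cstar_identity BP x. Qed.

Let scale_i2 x : 'i *: ('i *: x) = - x.
Proof. by rewrite scalerA -expr2 sqr_i scaleN1r. Qed.

Lemma cstar_nrm1_le1 : nrm 1 <= 1.
Proof.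
have := nrm_sq 1; rewrite st1 mulr1; have := nrm_ge0 1.
by case: (lerP (nrm 1) 1) => // ? ? /eqP; rewrite expr2; nra.
Qed.

Lemma cstar_nrm_st x : nrm (st x) = nrm x.
Proof.
suff le y : nrm y <= nrm (st y).
  by apply/eqP; rewrite eq_le le andbT; have := le (st x); rewrite stK.
have := nrm_sq y; have := nrmM (st y) y; have := nrm_ge0 y.
have [->|n0] := eqVneq (nrm y) 0; first by move=> _ _ _; exact: nrm_ge0.
rewrite le_eqVlt eq_sym (negPf n0) /= => y0 + e; rewrite e expr2.
by rewrite ler_pM2r.
Qed.

Lemma cstar_nrm_sa h : st h = h -> nrm (h * h) = nrm h ^+ 2.
Proof. by move=> sh; rewrite -{1}sh nrm_sq. Qed.

Lemma cstar_isometry_le1 x : st x * x = 1 -> nrm x <= 1.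
Proof.
move=> e; have := nrm_sq x; rewrite e; have := cstar_nrm1_le1.
have := nrm_ge0 x; rewrite expr2; case: (lerP (nrm x) 1) => // ? ? ?; nra.
Qed.

Lemma cstar_nrm_scale1_le r : nrm (r%:C *: 1) <= `|r|.
Proof. by rewrite nrmZ; apply: ler_piMr => //; exact: cstar_nrm1_le1. Qed.

(** The inverse is the fixed point of y |-> 1 + xy among the elements commuting with [x];
    commutation makes this right inverse two-sided, and |y| <= 1 + |x| |y| gives the bound. *)
Lemma neumann1 x : nrm x < 1 ->
  exists y, [/\ y * (1 - x) = 1, (1 - x) * y = 1 & nrm y <= (1 - nrm x)^-1].
Proof.
move=> x1.
have [|||u l||y xy fy] := @contraction_fixpoint R B nrm nrmP
  (fun y => x * y = y * x) (fun y => 1 + x * y) (nrm x) 0.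
- by rewrite nrm_ge0.
- by rewrite mulr0 mul0r.
- by move=> y e; rewrite mulrDr mulrDl mulr1 mul1r -mulrA e.
- move=> ux ul.
  have lipl y z : nrm (x * y - x * z) <= nrm x * nrm (y - z).
    by rewrite -mulrBr; exact: nrmM.
  have lipr y z : nrm (y * x - z * x) <= nrm x * nrm (y - z).
    by rewrite -mulrBl mulrC; exact: nrmM.
  have cl := converges_lipschitz nrmP lipl ul.
  have cr := converges_lipschitz nrmP lipr ul.
  apply: (converges_unique nrmP cl) => e /cr[N NP].
  by exists N => n /NP; rewrite /= ux.
- move=> y z _ _; rewrite opprD addrACA subrr add0r -mulrBr; exact: nrmM.
exists y; split.
- by rewrite mulrBr mulr1 -xy -{1}fy addrK.
- by rewrite mulrBl mul1r -{1}fy addrK.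
have x0 : 0 < 1 - nrm x by lra.
rewrite -(ler_pM2l x0) divff ?gt_eqF //.
have := nrmD 1 (x * y); rewrite fy; have := nrmM x y; have := cstar_nrm1_le1.
by rewrite mulrBl; lra.
Qed.

Lemma neumann (k : R[i]) r x : `|k| = r%:C -> nrm x < r ->
  exists y, [/\ y * (k *: 1 - x) = 1, (k *: 1 - x) * y = 1
              & nrm y <= (r - nrm x)^-1].
Proof.
move=> kr xr; have r0 : 0 < r by apply: le_lt_trans xr; exact: nrm_ge0.
have k0 : k != 0.
  apply/eqP => k0; move: kr; rewrite k0 normr0 => /complexI e.
  by rewrite -e ltxx in r0.
have nk z : nrm (k^-1 *: z) = r^-1 * nrm z.
  apply: complexI; rewrite (norm_homog nrmP) normfV kr -fmorphV.
  by rewrite -rmorphM.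
have [|y [yx xy ny]] := neumann1 (x := k^-1 *: x).
  by rewrite nk mulrC ltr_pdivrMr ?mul1r.
have e : k *: 1 - x = k *: (1 - k^-1 *: x).
  by rewrite scalerBr scalerA divff // scale1r.
exists (k^-1 *: y); split.
- by rewrite e -scalerAr -scalerAl scalerA divff // scale1r.
- by rewrite e -scalerAr -scalerAl scalerA mulVf // scale1r.
rewrite nk; rewrite nk in ny.
have -> : (r - nrm x)^-1 = r^-1 * (1 - r^-1 * nrm x)^-1.
  rewrite -invfM mulrBr mulr1 mulrA divff ?mul1r //.
  by rewrite gt_eqF.
by apply: ler_wpM2l ny; rewrite invr_ge0 ltW.
Qed.

Lemma neumann_real r x : 0 <= r -> nrm x < r ->
  exists y, [/\ y * (r%:C *: 1 - x) = 1, (r%:C *: 1 - x) * y = 1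
              & nrm y <= (r - nrm x)^-1].
Proof.
move=> r0; apply: neumann.
by rewrite normc_def /= expr0n addr0 sqrtr_sqr ger0_norm.
Qed.

(* h - i = (h + it) - i(t+1), and |h + it|^2 = |h^2 + t^2| < (t+1)^2 for large
   real t. *)
Lemma sa_sub_i_invertible h : st h = h -> invertible (h - 'i *: 1).
Proof.
(* For this [t] the square of the norm is at most |h|^2 + t^2 = t + t^2, which is below (t +
   1)^2. *)
move=> sh; pose t := nrm h ^+ 2.
have t0 : 0 <= t by rewrite exprn_ge0.
pose a := - (h + 'i *: (t%:C *: 1)).
have na : nrm a < t + 1.
  have sa : st a * a = h * h + (t ^+ 2)%:C *: 1.
    rewrite stN mulrNN stD sti stZr st1 sh mulrDr !mulrDl.
    rewrite !mulNr scalerA mulr_algr !mulr_algl addrA subrK scalerA mulrACA.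
    by rewrite -(expr2 'i) sqr_i mulN1r scaleNr opprK -rmorphM.
  have := nrm_sq a; rewrite sa => e.
  have : nrm a ^+ 2 <= t + t ^+ 2.
    rewrite -e; apply: le_trans (nrmD _ _) _; apply: lerD.
      by rewrite cstar_nrm_sa.
    apply: le_trans (cstar_nrm_scale1_le _) _.
    by rewrite ger0_norm // exprn_ge0.
  have := nrm_ge0 a; rewrite ltNge => a0 le; apply/negP => lt.
  have : (t + 1) * (t + 1) <= nrm a * nrm a by apply: ler_pM => //; lra.
  by rewrite !expr2 in le *; lra.
have [|y [yx xy _]] := neumann (k := - ('i * (t + 1)%:C)) _ na.
  rewrite normrN normrM !normc_def /= !expr0n expr1n add0r addr0 sqrtr1.
  by rewrite mul1r sqrtr_sqr ger0_norm //; lra.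
have e : - ('i * (t + 1)%:C) *: 1 - a = h - 'i *: 1.
  rewrite /a opprK scaleNr -scalerA rcD scalerDl rmorph1 scale1r scalerDr.
  by rewrite opprD addrC addrA addrK.
by exists y; rewrite -e.
Qed.

(** * Norm bounds for self-adjoint elements *)

Let sumdif x y : (x + y) - (x - y) = y + y.
Proof. by rewrite opprB addrC addrA subrK. Qed.

Let half : R[i] := (2^-1 : R)%:C.

Let halfD x : half *: (x + x) = x.
Proof.
rewrite -mulr2n -scaler_nat scalerA /half -(rmorph_nat (real_complex R)).
by rewrite -rmorphM mulVf ?pnatr_eq0 // rmorph1 scale1r.
Qed.

(* c = 1 - s, where s is the fixed point of s |-> (w^2 + s^2) / 2. *)
Lemma sa_complement w : st w = w -> nrm w < 1 ->
  exists c, [/\ st c = c, c * w = w * c & w * w + c * c = 1].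
Proof.
move=> sw w1; have w0 := nrm_ge0 w.
pose r := nrm w ^+ 2.
have r01 : 0 <= r < 1 by rewrite /r expr2; apply/andP; split; nra.
have [r0 r1] := andP r01.
have nF x : nrm (half *: x) = 2^-1 * nrm x.
  by rewrite /half nrmZ ger0_norm // invr_ge0.
(* On the ball of radius r = |w|^2 the map has Lipschitz constant r, and it preserves the ball since
   (r + r^2) / 2 <= r. At the fixed point w^2 + s^2 = 2s, that is w^2 + (1 - s)^2 = 1. *)
have [||u l Du ul|x y|s [_ ss sws] fs] := @contraction_fixpoint R B nrm nrmP
  (fun s => [/\ nrm s <= r, st s = s & s * w = w * s])
  (fun s => half *: (w * w + s * s)) r 0 r01.
- by split; rewrite ?(nrm0 nrmP) ?st0 ?mulr0 ?mul0r.
- move=> s [sr ss sws]; split.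
  + rewrite nF; have := nrmD (w * w) (s * s); rewrite (cstar_nrm_sa sw).
    have : nrm (s * s) <= r * r by apply: le_trans (nrmM _ _) _; exact: ler_pM.
    by rewrite -/r; nra.
  + by rewrite /half stZr stD !stM sw ss.
  + rewrite -scalerAl -scalerAr mulrDl mulrDr -!mulrA sws.
    by rewrite (mulrA s w s) sws -mulrA.
- split.
  + by apply: (converges_le nrmP _ ul) => n; have [] := Du n.
  + have lip x y : nrm (st x - st y) <= 1 * nrm (x - y).
      by rewrite mul1r -stB cstar_nrm_st.
    have sl := converges_lipschitz nrmP lip ul.
    apply: (converges_unique nrmP sl) => e /ul[N NP].
    by exists N => n /NP; have [_ /= -> _] := Du n.
  + have lipl x y : nrm (w * x - w * y) <= nrm w * nrm (x - y).
      by rewrite -mulrBr; exact: nrmM.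
    have lipr x y : nrm (x * w - y * w) <= nrm w * nrm (x - y).
      by rewrite -mulrBl mulrC; exact: nrmM.
    have cl := converges_lipschitz nrmP lipl ul.
    have cr := converges_lipschitz nrmP lipr ul.
    apply: (converges_unique nrmP cr) => e /cl[N NP].
    by exists N => n /NP; have [_ _ /= ->] := Du n.
- move=> [xr _ _] [yr _ _].
  rewrite -scalerBr opprD addrACA subrr add0r nF.
  have -> : x * x - y * y = x * (x - y) + (x - y) * y.
    by rewrite mulrBr mulrBl addrA subrK.
  have := nrmD (x * (x - y)) ((x - y) * y); have := nrm_ge0 (x - y).
  have := nrmM x (x - y); have := nrmM (x - y) y.
  set d := nrm (x - y) => a1 a2 d0.
  have : nrm x * d <= r * d by exact: ler_wpM2r.
  have : d * nrm y <= d * r by exact: ler_wpM2l.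
  by lra.
exists (1 - s); split.
- by rewrite stB st1 ss.
- by rewrite mulrBl mulrBr mul1r mulr1 sws.
have e : w * w + s * s = s + s by rewrite -{3 4}fs -scalerDr halfD.
rewrite mulrBl mul1r mulrBr mulr1.
rewrite opprB addrA [_ + (1 - s)]addrC addrA -[1 - s + _ + _]addrA e.
by rewrite addrA subrK addrK.
Qed.

(* w + ic is unitary. *)
Lemma sa_pythagoras_le1 w c : st w = w -> st c = c -> c * w = w * c ->
  w * w + c * c = 1 -> [/\ nrm w <= 1, nrm c <= 1 & nrm (w * c) <= 2^-1].
Proof.
move=> sw sc cw e.
pose C := 'i *: c.
have Cw : C * w = w * C by rewrite -scalerAl cw scalerAr.
have CC : C * C = - (c * c) by rewrite -scalerAl -scalerAr scale_i2.
have nU : nrm (w + C) <= 1.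
  apply: cstar_isometry_le1; rewrite stD sw sti sc -/C.
  rewrite mulrDr !mulrBl Cw CC addrA subrK -e.
  by rewrite opprK.
have nV : nrm (w - C) <= 1 by rewrite -cstar_nrm_st stB sw sti sc opprK.
have dbl x : nrm (x + x) = 2 * nrm x.
  by rewrite -mulr2n -scaler_nat -(rmorph_nat (real_complex R)) nrmZ ger0_norm.
have nwC : nrm (w * c) = nrm (w * C) by rewrite -scalerAr nrmi.
have nC : nrm c = nrm C by rewrite nrmi.
split.
- have := nrmD (w + C) (w - C).
  by rewrite addrACA subrr addr0 dbl; lra.
- have := nrmB (w + C) (w - C); rewrite sumdif dbl -nC; lra.
(* The squares of w + C and w - C differ by 4wC, which yields the bound 1/2. *)
have sq x : nrm x <= 1 -> nrm (x * x) <= 1.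
  by move=> x1; apply: le_trans (nrmM _ _) _; apply: mulr_ile1.
have := sq _ nU; have := sq _ nV.
have := nrmB ((w + C) * (w + C)) ((w - C) * (w - C)).
have -> : (w + C) * (w + C) = w * w + C * C + (w * C + w * C).
  by rewrite mulrDr !mulrDl Cw -!addrA; congr (_ + _); rewrite addrA addrC.
have -> : (w - C) * (w - C) = w * w + C * C - (w * C + w * C).
  by rewrite mulrBr !mulrBl Cw opprB addrACA -opprD.
by rewrite sumdif !dbl nwC; lra.
Qed.

(** For w = h / r with complement c, r^2 - h^2 = r^2 c^2 and h^2 (r^2 - h^2) = r^4 (wc)^2, where |c|
    <= 1 and |wc| <= 1/2. *)
Lemma sa_square_bounds h r : st h = h -> nrm h < r ->
  nrm ((r ^+ 2)%:C *: 1 - h * h) <= r ^+ 2 /\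
  nrm (h * h * ((r ^+ 2)%:C *: 1 - h * h)) <= r ^+ 4 / 4.
Proof.
move=> sh hr; have r0 : 0 < r := le_lt_trans (nrm_ge0 h) hr.
pose w := (r^-1)%:C *: h.
have sw : st w = w by rewrite stZr sh.
have w1 : nrm w < 1.
  by rewrite nrmZ gtr0_norm ?invr_gt0 // mulrC ltr_pdivrMr ?mul1r.
have [c [sc cw e]] := sa_complement sw w1.
have [_ c1 wc] := sa_pythagoras_le1 sw sc cw e.
have hw : h = r%:C *: w.
  by rewrite /w scalerA -rmorphM divff ?gt_eqF // rmorph1 scale1r.
have hh : h * h = (r ^+ 2)%:C *: (w * w).
  by rewrite hw -scalerAl -scalerAr scalerA -rmorphM.
have d : (r ^+ 2)%:C *: 1 - h * h = (r ^+ 2)%:C *: (c * c).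
  by rewrite hh -e scalerDr addrC addKr.
have r2 : 0 <= r ^+ 2 by rewrite exprn_ge0 // ltW.
split.
  rewrite d nrmZ ger0_norm //; apply: ler_piMr => //.
  by apply: le_trans (nrmM _ _) _; apply: mulr_ile1.
rewrite d hh -scalerAl -scalerAr scalerA -rmorphM -exprD nrmZ.
rewrite ger0_norm ?exprn_even_ge0 //.
apply: ler_wpM2l; first exact: exprn_even_ge0.
have -> : w * w * (c * c) = w * c * (w * c).
  by rewrite -!mulrA (mulrA c w c) cw -mulrA.
apply: le_trans (nrmM _ _) _; have := nrm_ge0 (w * c); nra.
Qed.

(** [f] carries the relation w^2 + c^2 = 1 to f(w)^2 + f(c)^2 = 1, so |f w| <= 1 for self-adjoint w
    of norm below 1. The C*-identity reduces the general case to x^dag x. *)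
Lemma cstar_endomorphism_le (f : B -> B) : linear f -> f 1 = 1 ->
  (forall x y, f (x * y) = f x * f y) -> (forall x, f (st x) = st (f x)) ->
  forall x, nrm (f x) <= nrm x.
Proof.
move=> fL f1 fM fst.
have fZ (k : R[i]) x : f (k *: x) = k *: f x.
  have f0 : f 0 = 0.
    by have := fL (-1) 0 0; rewrite scaler0 addr0 scaleN1r addNr.
  by have := fL k x 0; rewrite f0 !addr0.
have fD x y : f (x + y) = f x + f y by have := fL 1 x y; rewrite !scale1r.
have sa h : st h = h -> nrm (f h) <= nrm h.
  move=> sh; rewrite leNgt; apply/negP => lt.
  set r := nrm (f h) in lt; have r0 : 0 < r := le_lt_trans (nrm_ge0 h) lt.
  (* A scale strictly between |h| and |f h|: h / s then has norm below 1 while its image would have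
     norm above 1. *)
  pose s := (r + nrm h) / 2.
  have [s0 hs sr] : [/\ 0 < s, nrm h < s & s < r].
    by have := nrm_ge0 h; rewrite /s => ?; split; lra.
  pose w := (s^-1)%:C *: h.
  have sw : st w = w by rewrite stZr sh.
  have w1 : nrm w < 1.
    by rewrite nrmZ gtr0_norm ?invr_gt0 // mulrC ltr_pdivrMr ?mul1r.
  have [c [sc cw e]] := sa_complement sw w1.
  have [||||] := @sa_pythagoras_le1 (f w) (f c).
  - by rewrite -fst sw.
  - by rewrite -fst sc.
  - by rewrite -!fM cw.
  - by rewrite -!fM -fD e.
  rewrite fZ nrmZ gtr0_norm ?invr_gt0 // mulrC ler_pdivrMr // mul1r -/r.
  by rewrite leNgt sr.
move=> x.
have := sa (st x * x); rewrite stM stK fM fst !nrm_sq => /(_ erefl).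
by rewrite ler_pXn2r // nnegrE.
Qed.

(** * Positivity of x^dag x *)

(* Membership of the positive cone expressed through the norm only, so that
   stability under sums is the triangle inequality. *)
Definition norm_positive x := exists2 t : R, 0 <= t & nrm (t%:C *: 1 - x) <= t.

Lemma norm_positiveD x y :
  norm_positive x -> norm_positive y -> norm_positive (x + y).
Proof.
move=> [t t0 xt] [s s0 ys]; exists (t + s); first exact: addr_ge0.
rewrite rcD scalerDl opprD addrACA.
by apply: le_trans (nrmD _ _) _; exact: lerD.
Qed.

Lemma norm_positive_sqr h : st h = h -> norm_positive (h * h).
Proof.
move=> sh; exists ((nrm h + 1) ^+ 2); first by rewrite exprn_ge0 // addr_ge0.
by have [|] := sa_square_bounds (r := nrm h + 1) sh; rewrite ?ltrDl.
Qed.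

Lemma norm_positive_half x : norm_positive x -> norm_positive (half *: x).
Proof.
move=> [t t0 xt]; exists (2^-1 * t); first by rewrite mulr_ge0 ?invr_ge0.
rewrite rcM -scalerA -scalerBr /half nrmZ ger0_norm ?invr_ge0 //.
by rewrite ler_wpM2l ?invr_ge0.
Qed.

(** r + x = (r + t) - (t - x) with |t - x| <= t, so the Neumann bound is at most 1 / (r + t - t). *)
Lemma norm_positive_inverse x r : norm_positive x -> 0 < r ->
  exists2 y, (r%:C *: 1 + x) * y = 1 & nrm y <= r^-1.
Proof.
move=> [t t0 xt] r0.
have [||y [_ xy ny]] := @neumann_real (r + t) (t%:C *: 1 - x).
- by rewrite addr_ge0 // ltW.
- by lra.
exists y.
  by rewrite -[RHS]xy rcD scalerDl opprB [x - _]addrC addrA addrK.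
apply: le_trans ny _; rewrite lef_pV2 ?posrE //; lra.
Qed.

Lemma cayley_bound x y : y * (1 + st x * x) = 1 -> (1 + st x * x) * y = 1 ->
  nrm (1 - (y + y)) <= 4.
Proof.
move=> yb by_.
have sb : st (1 + st x * x) = 1 + st x * x by rewrite stD stM stK st1.
have sy : st y = y.
  have e : (1 + st x * x) * st y = 1 by rewrite -sb -stM yb st1.
  by rewrite -[RHS]mulr1 -e mulrA yb mul1r.
pose Y := y + y; pose w := 1 - Y; pose z := x * Y.
have sY : st Y = Y by rewrite stD sy.
have sw : st w = w by rewrite stB st1 sY.
have bY : st x * x * Y = (1 + 1) - Y.
  have -> : st x * x * Y = (1 - y) + (1 - y).
    by rewrite mulrDr -by_ mulrDl mul1r [y + _]addrC addrK.
  by rewrite addrACA -opprD.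
(* With b = x^dag x and Y = 2y, bY = 2 - Y; hence z^dag z = Y (2 - Y) = 1 - (1 - Y)^2. *)
have zz : st z * z = 1 - w * w.
  rewrite stM sY -mulrA (mulrA (st x)) bY mulrBr mulrDr mulr1.
  rewrite mulrBl mul1r mulrBr mulr1 !opprB.
  by rewrite [RHS]addrCA subrKC addrAC.
clearbody z.
have D2 : norm_positive (1 + z * st z).
  (* [S1] and [S2] are, up to sign, twice the real and imaginary parts of [z], so S1^2 + S2^2 = 2 (z
     z^dag + z^dag z). *)
  pose S1 := z + st z; pose S2 := 'i *: (z - st z).
  have sS1 : st S1 = S1 by rewrite stD stK addrC.
  have sS2 : st S2 = S2 by rewrite sti stB stK -scalerN opprB.
  have -> : 1 + z * st z = w * w + (half *: (S1 * S1) + half *: (S2 * S2)).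
    rewrite -scalerDr.
    have -> : S1 * S1 + S2 * S2 = z * st z + st z * z + (z * st z + st z * z).
      rewrite -[S2 * S2]scalerAl -scalerAr scale_i2 /S1.
      rewrite mulrDr !mulrDl !mulrBr !mulNr opprK.
      rewrite [z * st z + st z * st z]addrC addrACA [st z * z + z * st z]addrC.
      rewrite [- (st z * z) + _]addrC [X in _ - X]addrACA -opprD.
      exact: sumdif.
    by rewrite halfD zz [RHS]addrCA subrKC addrC.
  apply: norm_positiveD; first exact: norm_positive_sqr.
  by apply: norm_positiveD; apply: norm_positive_half; exact: norm_positive_sqr.
rewrite leNgt; apply/negP; rewrite -/Y -/w; set W := nrm w => W4.
(* [r] need only exceed |w| slightly. With n = 1.21 W^2 and W > 4, the factor (1 + W^2) / (n - 2) is
   at most 1, and W^2 (n - 1) <= n^2 / 2 then fails. *)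
pose r := 11 / 10 * W; pose n := r ^+ 2.
have nE : n = 121 / 100 * W ^+ 2 by rewrite /n /r; field.
have W16 : 16 < W ^+ 2 by rewrite expr2; nra.
have l0 : 0 < n - 2 by rewrite nE; lra.
have [g zg ng] := norm_positive_inverse D2 l0.
have c0 : 0 < n - 1 by lra.
pose c := (n - 1)%:C : R[i].
have cn0 : c != 0 by rewrite /c (fmorph_eq0 (real_complex R)) gt_eqF.
have cE : (n - 2)%:C *: 1 + (1 + z * st z) = c *: 1 + z * st z.
  rewrite addrA; congr (_ + _).
  rewrite -{2}(scale1r 1) -(rmorph1 (real_complex R)).
  by rewrite -scalerDl -rcD /c; congr (_%:C *: _); ring.
rewrite cE in zg.
(* The inverse g of c + z z* yields the inverse (1 - z* g z) / c of c + z* z. *)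
have KY : (n%:C *: 1 - w * w) * (1 - st z * g * z) = c *: 1.
  have -> : n%:C *: 1 - w * w = c *: 1 + st z * z.
    rewrite zz addrA; congr (_ - _).
    rewrite -{3}(scale1r 1) -(rmorph1 (real_complex R)) -scalerDl -rcD /c.
    by congr (_%:C *: _); ring.
  rewrite mulrBr mulr1.
  have -> : (c *: 1 + st z * z) * (st z * g * z) =
            st z * ((c *: 1 + z * st z) * g) * z.
    rewrite !mulrA; do 2!congr (_ * _).
    by rewrite mulrDr mulrDl mulr_algl mulr_algr mulrA.
  by rewrite zg mulr1 addrK.
have Wr : nrm w < r by rewrite -/W /r; lra.
have [_ b4] := sa_square_bounds sw Wr; rewrite -/n in b4.
(* w^2 is written as w^2 (n - w^2) times the inverse of n - w^2; the latter is bounded through |g|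
   <= 1 / (n - 2) and |z|^2 = |1 - w^2| <= 1 + W^2. *)
have WE : W ^+ 2 <= n ^+ 2 / 4 * ((n - 1)^-1 * (1 + (1 + W ^+ 2) / (n - 2))).
  rewrite -[leLHS](cstar_nrm_sa sw).
  have -> : w * w = w * w * (n%:C *: 1 - w * w) * (c^-1 *: (1 - st z * g * z)).
    by rewrite -[RHS]mulrA -scalerAr KY scalerA mulVf // scale1r mulr1.
  apply: le_trans (nrmM _ _) _; apply: ler_pM => //.
    by apply: le_trans b4 _; rewrite -exprM.
  rewrite /c -fmorphV nrmZ ger0_norm ?invr_ge0 ?(ltW c0) //.
  apply: ler_wpM2l; first by rewrite invr_ge0 ltW.
  apply: le_trans (nrmB _ _) (lerD cstar_nrm1_le1 _).
  apply: le_trans (nrmM _ _) _.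
  apply: le_trans (ler_wpM2r (nrm_ge0 _) (nrmM _ _)) _.
  rewrite cstar_nrm_st mulrAC -expr2 -nrm_sq; apply: ler_pM => //.
  rewrite zz; apply: le_trans (nrmB _ _) (lerD cstar_nrm1_le1 _).
  by rewrite cstar_nrm_sa.
move: WE W16; rewrite mulrCA ler_pdivlMl // nE; set P := W ^+ 2 => WE W16.
have q : (1 + P) / (121 / 100 * P - 2) <= 1 by rewrite ler_pdivrMr ?mul1r; lra.
have : (121 / 100 * P) ^+ 2 / 4 * (1 + (1 + P) / (121 / 100 * P - 2)) <=
       (121 / 100 * P) ^+ 2 / 4 * 2.
  by apply: ler_wpM2l; [rewrite divr_ge0 ?exprn_even_ge0 | lra].
move/(le_trans WE); rewrite expr2; nra.
Qed.

Lemma scale_star_sqr r x :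
  st (r%:C *: x) * (r%:C *: x) = (r ^+ 2)%:C *: (st x * x).
Proof. by rewrite stZr -scalerAl -scalerAr scalerA -rcM. Qed.

(** 1 + (9/8)^2 b factors as (1 + d b y) (1 + b), and the first factor is a Neumann perturbation of
    1. The ratio 9/8 works because its square exceeds 1 by less than 2/5. *)
Lemma invertible_1D_step x : invertible (1 + st x * x) ->
  invertible (1 + st ((9 / 8)%:C *: x) * ((9 / 8)%:C *: x)).
Proof.
move=> [y [yb by_]]; have W4 := cayley_bound yb by_.
rewrite scale_star_sqr; move: (st x * x) yb by_ => b yb by_.
have by1 : b * y = 1 - y by rewrite -by_ mulrDl mul1r [y + _]addrC addrK.
(* d = (9/8)^2 - 1, and |1 - y| <= 5/2 by the bound on 1 - 2y. *)
pose d : R := 17 / 64.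
have ny : nrm (- (d%:C *: (b * y))) < 1.
  have e : 1 - y = half *: (1 + (1 - (y + y))).
    by rewrite -[LHS]halfD addrACA -opprD addrA.
  rewrite nrmN nrmZ by1 e /half nrmZ !ger0_norm ?invr_ge0 ?divr_ge0 //.
  have := nrmD 1 (1 - (y + y)); have := cstar_nrm1_le1; rewrite /d; lra.
have [u [uv vu _]] := neumann1 ny; rewrite opprK in uv vu.
have e : 1 + ((9 / 8) ^+ 2)%:C *: b = (1 + d%:C *: (b * y)) * (1 + b).
  rewrite [RHS]mulrDl mul1r -scalerAl -mulrA yb mulr1 -addrA; congr (_ + _).
  rewrite -{2}(scale1r b) -(rmorph1 (real_complex R)) -scalerDl -rcD.
  by congr (_%:C *: _); rewrite /d; field.
exists (y * u); rewrite e; split.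
  by rewrite -!mulrA (mulrA u) uv mul1r.
by rewrite -!mulrA (mulrA (1 + b)) by_ mul1r.
Qed.

(** The Neumann series settles |x| < 1; each step enlarges the admissible norm by the fixed factor
    9/8, so finitely many steps reach any [x]. *)
Lemma invertible_1D_star_sqr x : invertible (1 + st x * x).
Proof.
have small z : nrm z < 1 -> invertible (1 + st z * z).
  move=> z1; have [|y [yb by_ _]] := @neumann1 (- (st z * z)).
    by rewrite nrmN nrm_sq expr2; have := nrm_ge0 z; nra.
  by exists y; rewrite opprK in yb by_.
have step n : forall z, nrm z < (9 / 8) ^+ n -> invertible (1 + st z * z).
  elim: n => [|n IH] z; first by rewrite expr0; exact: small.
  rewrite exprS => zn.
  have zE : z = (9 / 8)%:C *: ((8 / 9)%:C *: z).
    rewrite scalerA -rcM (_ : 9 / 8 * (8 / 9) = 1) ?rmorph1 ?scale1r //.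
    by field.
  rewrite zE; apply: invertible_1D_step; apply: IH.
  by rewrite nrmZ ger0_norm; lra.
have rho : 0 <= (8 / 9 : R) < 1 by lra.
have [N /(_ N (leqnn N)) NP] := geometric_small rho ltr01 (nrm_ge0 x).
apply: (step N); move: NP; rewrite -ltr_pdivlMr ?exprn_gt0 ?divr_gt0 //.
by rewrite mul1r -exprVn invf_div.
Qed.

Lemma cstar_star_sqr_resolvent x (l : R[i]) : ~~ (0 <= l) ->
  invertible (st x * x - l *: 1).
Proof.
have scl (k : R[i]) z : k != 0 -> invertible z -> invertible (k *: z).
  move=> k0 [y [yz zy]]; exists (k^-1 *: y).
  by rewrite -!scalerAl -!scalerAr !scalerA yz zy mulVf // divff // scale1r.
case: l => a b; rewrite lecE /= negb_and => l0.
have [b0|bn] := eqVneq b 0.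
  rewrite b0 eqxx /= -ltNge in l0 *.
  have sa0 : 0 < - a by lra.
  (* A negative l = -s^2 gives x^dag x - l = s^2 (1 + (x/s)^dag (x/s)). *)
  set s := Num.sqrt (- a); have s2 : s ^+ 2 = - a by rewrite sqr_sqrtr // ltW.
  have sn : s != 0 by rewrite sqrtr_eq0 -ltNge.
  have -> : st x * x - (a +i* 0) *: 1 =
            (s ^+ 2)%:C *: (1 + st ((s^-1)%:C *: x) * ((s^-1)%:C *: x)).
    rewrite scale_star_sqr scalerDr scalerA -rcM exprVn divff ?expf_neq0 //.
    rewrite scale1r s2 addrC -scaleNr; congr (_ *: _ + _).
    by apply/eqP; rewrite eq_complex /= oppr0 !eqxx.
  apply: scl (invertible_1D_star_sqr _).
  by rewrite (fmorph_eq0 (real_complex R)) expf_neq0.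
(* For l = a + ib with b nonzero, x^dag x - l = b (h - i) with [h] self-adjoint. *)
pose h := (b^-1)%:C *: (st x * x - a%:C *: 1).
have -> : st x * x - (a +i* b) *: 1 = b%:C *: (h - 'i *: 1).
  rewrite scalerBr !scalerA -rcM divff // scale1r -addrA -opprD -scalerDl.
  congr (_ - _ *: _); apply/eqP; rewrite eq_complex /=.
  by rewrite !(mul0r, mulr0, mulr1, subr0, addr0, add0r) !eqxx.
apply: scl; first by rewrite (fmorph_eq0 (real_complex R)).
by apply: sa_sub_i_invertible; rewrite stZr stB stM stK stZr st1.
Qed.

End CstarAlgebra.

(** * Transfer to algebras given by plain operations, including the zero algebra *)

Section PlainOperations.
Variables (R : realType) (A : lmodType R[i]) (mul : A -> A -> A) (one : A).
Hypothesis U : unital_algebra mul one.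

Let mulDl : left_distributive mul +%R.
Proof. by move=> x y z; have := alg_linearl U z 1 x y; rewrite !scale1r. Qed.
Let mulDr : right_distributive mul +%R.
Proof. by move=> x y z; have := alg_linearr U x 1 y z; rewrite !scale1r. Qed.
Let mul0l x : mul 0 x = 0.
Proof. by apply: (addrI (mul 0 x)); rewrite -mulDl !addr0. Qed.
Let mul0r x : mul x 0 = 0.
Proof. by apply: (addrI (mul x 0)); rewrite -mulDr !addr0. Qed.
Lemma unital_algebra_eq0 (x : A) : one = 0 -> x = 0.
Proof. by move=> o0; rewrite -(alg_mul1l U x) o0 mul0l. Qed.
Let scaleAl (k : R[i]) x y : k *: mul x y = mul (k *: x) y.
Proof. by have := alg_linearl U y k x 0; rewrite mul0l !addr0. Qed.
Let scaleAr (k : R[i]) x y : k *: mul x y = mul x (k *: y).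
Proof. by have := alg_linearr U x k y 0; rewrite mul0r !addr0. Qed.

(* MathComp algebras are nonzero by definition, unlike unital_algebra. *)
Definition nonzero_algebra of one != 0 : Type := A.

Variable nz : one != 0.
Local Notation B := (nonzero_algebra nz).

HB.instance Definition _ := GRing.Lmodule.on B.
HB.instance Definition _ := GRing.Zmodule_isNzRing.Build B
  (alg_mulA U) (alg_mul1l U) (alg_mul1r U) mulDl mulDr nz.
HB.instance Definition _ :=
  GRing.LSemiModule_isLSemiAlgebra.Build R[i] B scaleAl.
HB.instance Definition _ :=
  GRing.LSemiAlgebra_isSemiAlgebra.Build R[i] B scaleAr.

Definition nonzero_algType : algType R[i] := B.

End PlainOperations.

Section PlainCstarAlgebra.
Variables (R : realType) (A : lmodType R[i]) (mul : A -> A -> A) (one : A).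
Variables (st : A -> A) (nrm : A -> R).
Hypothesis BP : unital_cstar_algebra mul one st nrm.

Let U := cstar_algebra BP.

Let BP' (nz : one != 0) :
  unital_cstar_algebra ( *%R : nonzero_algType U nz -> _ -> _) 1 st nrm.
Proof.
case: BP => [[mA m1l m1r ml mr] [sL sK sM] [[nD nZ n0 nc] nM] nC].
do 4?split => //.
Qed.

Lemma cstar_positive_resolvent (x : A) (l : R[i]) : ~~ (0 <= l) ->
  exists y, mul y (mul (st x) x - l *: one) = one /\
            mul (mul (st x) x - l *: one) y = one.
Proof.
(* In the zero algebra all elements coincide, so 0 is an inverse. *)
move=> l0; have [o0|nz] := eqVneq one 0.
  by exists 0; rewrite !(unital_algebra_eq0 U (mul _ _) o0) o0.
have [y e] := cstar_star_sqr_resolvent (BP' nz) x l0.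
exists y; exact: e.
Qed.

Lemma cstar_endomorphism_contractive (f : A -> A) : linear f -> f one = one ->
  (forall x y, f (mul x y) = mul (f x) (f y)) ->
  (forall x, f (st x) = st (f x)) -> forall x, nrm (f x) <= nrm x.
Proof.
move=> fL f1 fM fst x; have [o0|nz] := eqVneq one 0.
  by rewrite (unital_algebra_eq0 U (f x) o0) (unital_algebra_eq0 U x o0).
exact: (cstar_endomorphism_le (BP' nz)).
Qed.

End PlainCstarAlgebra.

(** * The C*-structure of a Kreĭn algebra and its closed graded parts *)

Section KreinAlgebra.
Variables (R : realType) (A : lmodType R[i]).
Variables (mul : A -> A -> A) (one : A) (star : A -> A).
Hypothesis hA : unital_krein_cstar_algebra mul one star.
Variable alpha : A -> A.
Hypothesis halpha : fundamental_symmetry mul star alpha.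

Let st x := alpha (star x).

Lemma fsym1 : alpha one = one.
Proof.
have [_ m1l m1r _ _] := krein_algebra hA.
by rewrite -[LHS]m1r -{2}(fsymK halpha one) -(fsymM halpha) m1l (fsymK halpha).
Qed.

Lemma krein_unital_cstar_algebra (nrm : A -> R) :
  banach_algebra_norm mul nrm ->
  (forall x, nrm (mul (alpha (star x)) x) = nrm x ^+ 2) ->
  unital_cstar_algebra mul one st nrm.
Proof.
move=> bP nC; have [sL sK sM] := krein_involution hA.
split => //; first exact: krein_algebra hA.
split=> [k x y|x|x y]; rewrite /st.
- by rewrite sL (fsym_linear halpha).
- by rewrite -(fsym_star halpha) (fsymK halpha) sK.
- by rewrite sM (fsymM halpha).
Qed.

(** [alpha] commutes with [star], hence with [st], and is thus a unital endomorphism of the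
    C*-algebra. This supplies its continuity. *)
Lemma fsym_contractive (nrm : A -> R) :
  banach_algebra_norm mul nrm ->
  (forall x, nrm (mul (alpha (star x)) x) = nrm x ^+ 2) ->
  forall x, nrm (alpha x) <= nrm x.
Proof.
move=> bP nC; have BP := krein_unital_cstar_algebra bP nC.
apply: (cstar_endomorphism_contractive BP (fsym_linear halpha) fsym1).
- exact: fsymM halpha.
- by move=> x; rewrite /st (fsym_star halpha).
Qed.

Lemma pm_pred_diag a x : (x \in pm_pred halpha a a) = (alpha x == x).
Proof. by rewrite unfold_in; case: a. Qed.

Lemma pm_part_fsym a b x :
  x \in pm_pred halpha a b -> alpha x \in pm_pred halpha a b.
Proof.
by rewrite !unfold_in; case: a; case: b;
  rewrite /= /even_part /odd_part => /eqP ex;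
  rewrite ex ?(linear_opp (fsym_linear halpha)) ex.
Qed.

Definition pm_fsym a b (x : pm_hom halpha a b) : pm_hom halpha a b :=
  PmHom (pm_part_fsym (pm_valP x)).

(** By contractivity alpha(v_n) tends to alpha(l); by parity it also tends to l or to -l. *)
Lemma pm_part_limit (nrm : A -> R) a b (v : nat -> A) l :
  banach_algebra_norm mul nrm ->
  (forall x, nrm (mul (alpha (star x)) x) = nrm x ^+ 2) ->
  (forall n, pm_part alpha a b (v n)) -> converges nrm v l ->
  pm_part alpha a b l.
Proof.
move=> bP nC vP vl; have bN := banach_algebra_banach bP.
have lip x y : nrm (alpha x - alpha y) <= 1 * nrm (x - y).
  have fB : alpha x - alpha y = alpha (x - y).
    by rewrite [x - y]addrC -(scaleN1r y) (fsym_linear halpha) scaleN1r addrC.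
  by rewrite fB mul1r; exact: fsym_contractive bP nC _.
have lipN x y : nrm (- x - - y) <= 1 * nrm (x - y).
  by rewrite mul1r -opprD (nrmN bN).
have al := converges_lipschitz bN lip vl.
have nl := converges_lipschitz bN lipN vl.
have even : (forall n, alpha (v n) = v n) -> alpha l = l.
  move=> e; apply: (converges_unique bN al) => d /vl[N NP].
  by exists N => n /NP; rewrite /= e.
have odd : (forall n, alpha (v n) = - v n) -> alpha l = - l.
  move=> e; apply: (converges_unique bN al) => d /nl[N NP].
  by exists N => n /NP; rewrite /= e.
by case: a b vP => [] [] /= vP; apply/eqP;
  [apply: even | apply: odd | apply: odd | apply: even] => n; apply/eqP/vP.
Qed.

Lemma pm_banach (nrm : A -> R) a b : banach_algebra_norm mul nrm ->
  (forall x, nrm (mul (alpha (star x)) x) = nrm x ^+ 2) ->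
  banach_norm (fun x : pm_hom halpha a b => nrm (pm_val x)).
Proof.
move=> bP nC; have [nD nZ n0 nc] := banach_algebra_banach bP; split.
- by move=> x y; exact: nD.
- by move=> k x; exact: nZ.
- by move=> x /n0 e; apply: val_inj.
move=> u uC; have [l ul] := nc (fun n => pm_val (u n)) uC.
have lP : l \in pm_pred halpha a b.
  rewrite unfold_in; apply: pm_part_limit ul => // n.
  by have := pm_valP (u n); rewrite unfold_in.
by exists (PmHom lP).
Qed.

End KreinAlgebra.

(** * The two-object category, normed by restriction of the algebra norm *)

Theorem theorem3p6 (R : realType) (A : lmodType R[i])
    (mul : A -> A -> A) (one : A) (star : A -> A)
    (hA : unital_krein_cstar_algebra mul one star)
    (alpha : A -> A) (halpha : fundamental_symmetry mul star alpha) :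
  krein_cstar_category (krein_algebra_category hA halpha).
Proof.
have [mA m1l m1r ml mr] := krein_algebra hA.
have [sL sK sM] := krein_involution hA.
have [nrm [bP nC]] := fsym_norm halpha.
have BP := krein_unital_cstar_algebra hA halpha bP nC.
have s1 : star one = one.
  by rewrite -[LHS]m1r -{2}(sK one) -sM m1r sK.
split.
  split=> /=.
  - by move=> a b c d x y z; apply: val_inj; exact: mA.
  - by move=> a b x; apply: val_inj; exact: m1l.
  - by move=> a b x; apply: val_inj; exact: m1r.
  - by move=> a b c y k x x'; apply: val_inj; exact: ml.
  - by move=> a b c x k y y'; apply: val_inj; exact: mr.
  - by move=> a b k x y; apply: val_inj; exact: sL.
  - by move=> a b x; apply: val_inj; exact: sK.
  - by move=> a; apply: val_inj; exact: s1.
  - by move=> a b c x y; apply: val_inj; exact: sM.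
exists (fun a b (x : pm_hom halpha a b) => nrm (pm_val x)).
exists (@pm_fsym _ _ _ _ _ halpha); split.
  by move=> a b; exact: (pm_banach hA halpha _ _ bP nC).
have cstarP (a : obj (krein_algebra_category hA halpha)) : unital_cstar_algebra
    (@Defs.comp _ (krein_algebra_category hA halpha) a a a)
    (idm (krein_algebra_category hA halpha) a)
    (fun y => pm_fsym (cstar y)) (fun x => nrm (pm_val x)).
  have [_ [L K M] _ _] := BP.
  split.
  - split=> /=.
    + by move=> x y z; apply: val_inj; exact: mA.
    + by move=> x; apply: val_inj; exact: m1l.
    + by move=> x; apply: val_inj; exact: m1r.
    + by move=> y k x x'; apply: val_inj; exact: ml.
    + by move=> x k y y'; apply: val_inj; exact: mr.
  - split=> /=.
    + by move=> k x y; apply: val_inj; exact: L.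
    + by move=> x; apply: val_inj; exact: K.
    + by move=> x y; apply: val_inj; exact: M.
  - split; first exact: (pm_banach hA halpha _ _ bP nC).
    by move=> x y; exact: (banach_algebra_normM bP).
  - by move=> x; exact: nC.
split=> //.
- split=> /=.
  + by move=> a; apply: val_inj; exact: fsym1 hA _ halpha.
  + by move=> a b c x y; apply: val_inj; exact: fsymM halpha _ _.
  + by move=> a b k x y; apply: val_inj; exact: fsym_linear halpha _ _ _.
  + by move=> a b x; apply: val_inj; exact: fsym_star halpha _.
- by move=> a b x; apply: val_inj; exact: fsymK halpha _.
- by move=> a b x; exact: nC.
move=> a b x; split.
  apply: val_inj => /=; have [_ [_ K M] _ _] := BP.
  by have := M (alpha (star (pm_val x))) (pm_val x); rewrite K.
(* Contraposition: outside the nonnegative reals the resolvent exists in the whole algebra, and it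
   remains to place it in A_+. *)
move=> l sp; apply: contraT => l0; case: sp.
have [y [yx xy]] := cstar_positive_resolvent BP (pm_val x) l0.
set X := Defs.comp _ x - l *: idm _ a.
have Xv : pm_val X = mul (alpha (star (pm_val x))) (pm_val x) - l *: one by [].
have Xe : alpha (pm_val X) = pm_val X.
  by apply/eqP; rewrite -(pm_pred_diag halpha a); exact: pm_valP.
(* As alpha fixes [X], alpha(y) is also a right inverse of [X], and so equals the left inverse
   [y]. *)
have ye : alpha y = y.
  rewrite -Xv in yx xy.
  have e : mul (pm_val X) (alpha y) = one.
    by rewrite -Xe -(fsymM halpha) xy (fsym1 hA halpha).
  by rewrite -[LHS]m1l -yx -mA e m1r.
have yP : y \in pm_pred halpha a a.
  by rewrite pm_pred_diag ye.
exists (PmHom yP); split; apply: val_inj.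
- exact: yx.
- exact: xy.
Qed.
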